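(* Consider a network and its auxiliary graph with sets $\{\Theta_l\}_{l\in\mathcal L}$, produced by the auxiliary graph construction. Let $\Omega$ denote the set of all subsets of $\mathcal S$ and define $\sigma:\Omega\to\mathbb{R}$ by $$\sigma(K)=\sum_{l\in\cup_{i\in K}L(i)}z_l^*\sum_{i\in K}I_{\{l\in L(i)\}}+\sum_{i\in K}y_i^*,$$ where $y_i^*=(\Delta\tilde x_i^k)^2(H_k)_{ii}$, $z_l^*=\frac{1}{|S(l)|}(\Delta\tilde x_{l+S}^k)^2(H_k)_{(l+S)(l+S)}$, and $I_{\{l\in L(i)\}}$ is the indicator function of the event $\{l\in L(i)\}$. Let $y_i(t)$ and $z_l(t)$ be the iterates generated by the distributed summation procedure: $z_l(0)=0$ for each link $l$, $y_i(0)=y_i^*+\sum_{l\in L(i)}z_l^*$ for each source $i$, and for $t=1,2,\dots,S$ $$z_l(t)=\sum_{i\in\Theta_l}y_i(t-1)-\bigl(|\Theta_l|-1\bigr)z_l(t-1),\qquad y_i(t)=\sum_{l\in L^*(i)}z_l(t)-\bigl(|L^*(i)|-1\bigr)y_i(t-1).$$ Then for all $t\in\{1,\dots,S\}$, the value $z_l(t)$ at each link $l$ satisfies $$z_l(t)=\sigma\Bigl(\bigcup_{i\in\Theta_l}\mathcal N_i(t-1)\Bigr),$$ and the value $y_i(t)$ at each source node $i$ satisfies $$y_i(t)=\sigma(\mathcal N_i(t)).$$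
   Context: For a source $i$, $\mathcal N_i(t)$ denotes the set of nodes connected to $i$ by a path of length at most $t$ in the auxiliary graph; $\mathcal N_i(0)=\{i\}$. $L^*=\{l:|\Theta_l|>1\}$ and $L^*(i)=\{l\in L^*: i\in\Theta_l\}$. $x^k\in\mathbb{R}^{S+L}$ is a strictly positive primal iterate of the inexact Newton method applied to minimizing $f(x)=-\sum_{i=1}^{S}U_i(x_i)-\mu\sum_{i=1}^{S+L}\log x_i$ ($\mu\ge1$; $U_i:\mathbb{R}_+\to\mathbb{R}$ strictly concave and nondecreasing on $(0,\infty)$, $-U_i$ self-concordant on $(0,\infty)$, i.e. three times continuously differentiable, convex, and $|g'''|\le2(g'')^{3/2}$ for $g=-U_i$) subject to $[R\ \ I(L)]x=c$, where $c>0$ is the vector of link capacities and $R\in\{0,1\}^{L\times S}$ has $R_{li}=1$ if and only if $l\in L(i)$. $H_k=\nabla^2 f(x^k)$ is diagonal and positive definite, and $\Delta\tilde x^k\in\mathbb{R}^{S+L}$ is the inexact Newton direction at $x^k$: its last $L$ components equal $-R$ times its first $S$ components $\Delta\tilde s_i^k=-(H_k)_{ii}^{-1}\bigl(\nabla_i f(x^k)+(R'\tilde w^k)_i\bigr)$ for some vector $\tilde w^k\in\mathbb{R}^L$ (an approximate dual vector). A network has links $\mathcal L=\{1,\dots,L\}$ and sources $\mathcal S=\{1,\dots,S\}$, each source $i$ having a predetermined route, an ordered sequence of links whose set is $L(i)$. $S(l)$ is the set of sources using link $l$. Each source traverses at least one link, each link is used by at least one source, and the links are connected in the sense that the graph on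 $\mathcal L$ in which two links are adjacent when some source uses both is connected. Auxiliary graph construction. The auxiliary graph is undirected with node set $\mathcal S$; its edges carry labels $L_l$, $l\in\mathcal L$. Each link $l$ stores a set $\Theta_l\subset\mathcal S$; each source is white or grey. Initialization: $\Theta_l=\emptyset$ for all $l$. One arbitrarily chosen source $i$ is marked grey, all others white; the grey source sends a signal $\{\text{label},i\}$ along its route, and each link $l\in L(i)$ adds $i$ to $\Theta_l$. Iteration: in each iteration all sources first perform (A), then all links perform (B), where whether $\Theta_l$ is empty is judged by its value at the beginning of the iteration. (A) Each white source $i$ computes $\sum_{l\in L(i)}|\Theta_l|$ using the values from the previous iteration. If the sum is positive, $i$ is marked grey and sends two signals, $\{\text{neighbor},i\}$ and $\{\text{label},i\}$, along its route; if the sum is $0$ it does nothing. Grey sources do nothing. (B) Each link $l$: (B.a) If $\Theta_l=\emptyset$ and one or more signals $\{\text{label},i\}$ pass through $l$, then the smallest such $i$ is added to $\Theta_l$; all signals keep traversing the rest of their routes. (B.b) If $\Theta_l\ne\emptyset$ and a signal $\{\text{neighbor},i\}$ passes through $l$, then an edge $(i,j)$ with label $L_l$ is added to the auxiliary graph for every $j\in\Theta_l$, and then $i$ is added to $\Theta_l$; if several neighbor signals arrive at $l$ in the same iteration, the corresponding sources are processed sequentially in this way, so that the nodes of $\Theta_l$ form a clique. Link $l$ then stops these neighbor signals (they are not passed further along their routes). All other signals are carried on. Termination: after $S-1$ iterations. $\Theta_l$ denotes the final sets. *)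

(* Defs.v *)
From HB Require Import structures.
From mathcomp Require Import all_boot all_order all_algebra all_fingroup.
From mathcomp Require Import all_classical all_reals all_analysis.
(* Imported last so that set0, setT and the like denote finite sets. *)
From mathcomp Require Import fintype finset.
Set Implicit Arguments.
Unset Strict Implicit.
Unset Printing Implicit Defensive.
Import Order.TTheory GRing.Theory Num.Theory.
Import numFieldNormedType.Exports.
Local Open Scope ring_scope.

Record network (nS nL : nat) := Network {
  route : 'I_nS -> seq 'I_nL;
  route_neq_nil : forall i, route i != [::];
  link_used : forall l, exists i, l \in route i;
  links_connected : forall l m,
    connect (fun l1 l2 : 'I_nL => (l1 != l2) &&
               [exists i, (l1 \in route i) && (l2 \in route i)]) l m }.

Section AuxiliaryGraph.
Variables (nS nL : nat) (net : network nS nL).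

Definition links (i : 'I_nS) : {set 'I_nL} := [set l | l \in route net i].

Definition users (l : 'I_nL) : {set 'I_nS} := [set i | l \in links i].

(* An undirected edge (i, j) labelled L_l is the pair ([set i; j], l). *)
Definition edge : Type := ({set 'I_nS} * 'I_nL)%type.

(* Sources outside grey are white. *)
Record state := State {
  grey : {set 'I_nS};
  Theta : 'I_nL -> {set 'I_nS};
  edges : {set edge} }.

Definition init_state (i0 : 'I_nS) : state :=
  State [set i0] (fun l => if l \in links i0 then [set i0] else set0) set0.

Definition new_grey (st : state) : {set 'I_nS} :=
  [set i | (i \notin grey st) && (0 < \sum_(l in links i) #|Theta st l|)%N].

(* The "label" signals passing through l: they are never stopped. *)
Definition label_signals (st : state) (l : 'I_nL) : {set 'I_nS} :=
  [set i in new_grey st | l \in links i].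

(* The "neighbor" signals reaching l: such a signal is stopped by the first
   link of its route whose set is nonempty at the beginning of the iteration. *)
Definition neighbor_signals (st : state) (l : 'I_nL) : {set 'I_nS} :=
  [set i in new_grey st | (l \in links i) &&
     all (fun m => Theta st m == set0) (take (index l (route net i)) (route net i))].

(* A singleton, or empty if A is. *)
Definition smallest (A : {set 'I_nS}) : {set 'I_nS} :=
  [set i in A | [forall j in A, (i <= j)%N]].

Definition process_neighbor (l : 'I_nL) (acc : {set 'I_nS} * {set edge})
    (i : 'I_nS) : {set 'I_nS} * {set edge} :=
  (i |: acc.1, acc.2 :|: [set ([set i; j], l) | j in acc.1]).

(* The permutation p gives the order in which l processes simultaneous
   neighbor signals: p 0, p 1, p 2, ..., those not reaching l being skipped. *)
Definition link_update (st : state) (l : 'I_nL) (p : {perm 'I_nS}) :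
    {set 'I_nS} * {set edge} :=
  if Theta st l == set0 then (smallest (label_signals st l), set0)
  else foldl (process_neighbor l) (Theta st l, set0)
         [seq i <- map p (enum 'I_nS) | i \in neighbor_signals st l].

Definition iteration (p : 'I_nL -> {perm 'I_nS}) (st : state) : state :=
  State (grey st :|: new_grey st)
        (fun l => (link_update st l (p l)).1)
        (edges st :|: \bigcup_(l : 'I_nL) (link_update st l (p l)).2).

Fixpoint state_after (i0 : 'I_nS) (order : nat -> 'I_nL -> {perm 'I_nS})
    (n : nat) : state :=
  if n is m.+1 then iteration (order m) (state_after i0 order m)
  else init_state i0.

Definition aux_graph (i0 : 'I_nS) (order : nat -> 'I_nL -> {perm 'I_nS}) :
    state := state_after i0 order nS.-1.

Variable G : state.

Definition adj : rel 'I_nS :=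
  fun i j => [exists l, ([set i; j], l) \in edges G].

Definition nbhd (i : 'I_nS) (t : nat) : {set 'I_nS} :=
  [set j | [exists n : 'I_t.+1, [exists p : n.-tuple 'I_nS,
     path adj i p && (last i p == j)]]].

Definition Lstar : {set 'I_nL} := [set l | (1 < #|Theta G l|)%N].

Definition Lstar_of (i : 'I_nS) : {set 'I_nL} :=
  [set l in Lstar | i \in Theta G l].

End AuxiliaryGraph.

Section NewtonDirection.
Variable R : realType.

Definition strictly_concave_pos (u : R -> R) : Prop :=
  forall a b t : R, 0 < a -> 0 < b -> a != b -> 0 < t < 1 ->
    t * u a + (1 - t) * u b < u (t * a + (1 - t) * b).

Definition nondecreasing_pos (u : R -> R) : Prop :=
  forall a b : R, 0 < a -> a <= b -> u a <= u b.

Definition self_concordant_pos (g : R -> R) : Prop :=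
  [/\ forall (n : nat) (a : R), (n < 3)%N -> 0 < a ->
        derivable (derive1n n g : R -> R) a 1,
      forall a : R, 0 < a -> {for a, continuous (derive1n 3 g : R -> R)},
      convex_function (`]0, +oo[%classic : set R^o) g
    & forall a : R, 0 < a ->
        `|derive1n 3 g a| <= 2 * (derive1n 2 g a) `^ (3 / 2)].

Definition utility (u : R -> R) : Prop :=
  [/\ strictly_concave_pos u, nondecreasing_pos u
    & self_concordant_pos (fun a => - u a)].

Definition gradient (n : nat) (f : 'cV[R]_n -> R) (x : 'cV[R]_n) : 'cV[R]_n :=
  \col_a 'D_(delta_mx a 0) f x.

Definition hessian (n : nat) (f : 'cV[R]_n -> R) (x : 'cV[R]_n) : 'M[R]_n :=
  \matrix_(a, b) 'D_(delta_mx b 0) (fun v => gradient f v a 0) x.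

Variables (nS nL : nat) (net : network nS nL).

Definition objective (U : 'I_nS -> R -> R) (mu : R) (x : 'cV[R]_(nS + nL)) : R :=
  - (\sum_(i < nS) U i (x (lshift nL i) 0))
  - mu * \sum_(j < nS + nL) ln (x j 0).

Definition routing_mx : 'M[R]_(nL, nS) :=
  \matrix_(l, i) (l \in links net i)%:R.

(* The vector x splits into source rates (usubmx x) and link slacks
   (dsubmx x); link l has index l + S, that is rshift nS l. *)
Definition feasible (c : 'cV[R]_nL) (x : 'cV[R]_(nS + nL)) : Prop :=
  row_mx routing_mx 1%:M *m x = c.

Definition inexact_newton_direction (f : 'cV[R]_(nS + nL) -> R)
    (x dx : 'cV[R]_(nS + nL)) : Prop :=
  (exists w : 'cV[R]_nL, forall i : 'I_nS,
     dx (lshift nL i) 0 =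
     - (hessian f x (lshift nL i) (lshift nL i))^-1 *
       (gradient f x (lshift nL i) 0 + (routing_mx^T *m w) i 0))
  /\ dsubmx dx = - (routing_mx *m usubmx dx).

Definition ystar (f : 'cV[R]_(nS + nL) -> R) (x dx : 'cV[R]_(nS + nL))
    (i : 'I_nS) : R :=
  dx (lshift nL i) 0 ^+ 2 * hessian f x (lshift nL i) (lshift nL i).

Definition zstar (f : 'cV[R]_(nS + nL) -> R) (x dx : 'cV[R]_(nS + nL))
    (l : 'I_nL) : R :=
  #|users net l|%:R^-1 *
    (dx (rshift nS l) 0 ^+ 2 * hessian f x (rshift nS l) (rshift nS l)).

Definition sigma (ys : 'I_nS -> R) (zs : 'I_nL -> R) (K : {set 'I_nS}) : R :=
  \sum_(l in \bigcup_(i in K) links net i)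
     zs l * (\sum_(i in K) (l \in links net i)%:R)
  + \sum_(i in K) ys i.

Definition summation_iterates (G : state nS nL) (ys : 'I_nS -> R)
    (zs : 'I_nL -> R) (y : nat -> 'I_nS -> R) (z : nat -> 'I_nL -> R) : Prop :=
  [/\ forall l, z 0%N l = 0,
      forall i, y 0%N i = ys i + \sum_(l in links net i) zs l,
      forall t l, (1 <= t <= nS)%N ->
        z t l = \sum_(i in Theta G l) y t.-1 i
                - (#|Theta G l|%:R - 1) * z t.-1 l
    & forall t i, (1 <= t <= nS)%N ->
        y t i = \sum_(l in Lstar_of G i) z t l
                - (#|Lstar_of G i|%:R - 1) * y t.-1 i].

End NewtonDirection.

(* Main.v *)
(** The map sigma is additive over sources: sigma K is the sum over i in K of
    the initial values y_i(0). The bipartite incidence graph between sources and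
    the sets Theta_l is a forest: a link acquires its first source (its head)
    once, and a source joins at most one nonempty link, the one that stops its
    neighbor signal. Hence the balls around the members of a fixed Theta_l, and
    likewise the unions of balls over the different links of a fixed source,
    form a sunflower whose kernel is the quantity of the previous step. Each
    recursion is then the inclusion-exclusion formula of a sunflower. *)

Require Import Defs.
From mathcomp Require Import all_boot all_order all_algebra all_fingroup.
From mathcomp Require Import all_classical all_reals all_analysis.
From mathcomp Require Import fintype finset.
Import Order.TTheory GRing.Theory Num.Theory.
Local Open Scope ring_scope.

Set Implicit Arguments.
Unset Strict Implicit.
Unset Printing Implicit Defensive.

(* The union is taken with the kernel C so that the formula also covers an
   empty family. *)
Lemma sum_sunflower (R : realType) (T I : finType) (w : T -> R)
    (P : {set I}) (A : I -> {set T}) (C : {set T}) :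
  (forall i, i \in P -> C \subset A i) ->
  (forall i j, i \in P -> j \in P -> i != j -> A i :&: A j \subset C) ->
  \sum_(v in C :|: \bigcup_(i in P) A i) w v
  = \sum_(i in P) \sum_(v in A i) w v - (#|P|%:R - 1) * \sum_(v in C) w v.
Proof.
move=> CA AC.
have split_petal i : i \in P ->
    \sum_(v in A i) w v = \sum_(v in C) w v + \sum_(v in A i :\: C) w v.
  by move=> iP; rewrite -{1}(setIidPr (CA i iP)) -big_setID.
rewrite (eq_bigr _ split_petal) big_split /= sumr_const.
rewrite (big_setID C) /= (setIidPr (subsetUl _ _)).
have -> : (C :|: \bigcup_(i in P) A i) :\: C = \bigcup_(i in P) (A i :\: C).
  rewrite finset.setDUl finset.setDv finset.set0U; apply/setP=> v; rewrite inE.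
  by apply/andP/bigcupP=> [[vC /bigcupP[i iP vi]]|[i iP /setDP[vi vC]]];
    [exists i => //; rewrite inE vC | split=> //; apply/bigcupP; exists i].
(* Indices outside [P] get an empty petal, so that disjointness is a statement about all of [I]. *)
rewrite [\bigcup_(i in P) _]big_mkcond /= partition_disjoint_bigcup.
  have petal i : \sum_(v in if i \in P then A i :\: C else finset.set0) w v
      = if i \in P then \sum_(v in A i :\: C) w v else 0.
    by case: ifP => // _; rewrite finset.big_set0.
  rewrite (eq_bigr _ (fun i _ => petal i)) -big_mkcond /= -[_ *+ _]mulr_natl.
  by rewrite mulrBl mul1r opprB [RHS]addrC addrA subrK.
move=> i j ij; case: ifP => iP; last by rewrite disjoints_subset finset.sub0set.
case: ifP => jP; last by rewrite disjoint_sym disjoints_subset finset.sub0set.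
rewrite -setI_eq0; apply/eqP/setP=> v; rewrite !inE.
apply/negP=> /andP[/andP[vC vi] /andP[_ vj]]; case/negP: vC.
by apply: (subsetP (AC i j iP jP ij)); rewrite inE vi.
Qed.

(** * Balls in a forest of overlapping sets *)

Section Forest.
Variables (T I : finType) (Theta : I -> {set T}).

Fixpoint ball (i : T) (t : nat) : {set T} :=
  if t is s.+1 then
    ball i s :|: \bigcup_(l | i \in Theta l) \bigcup_(k in Theta l) ball k s
  else [set i].

(** The shift by one follows the iterates [z]: empty at time 0, balls of radius [s] at time
    [s.+1]. *)
Definition link_ball (l : I) (t : nat) : {set T} :=
  if t is s.+1 then \bigcup_(k in Theta l) ball k s else set0.

(** Each set hangs below its head. The rank excludes cycles, and the second clause makes the parent
    of a source unique. *)
Definition forest (head : I -> T) (rank : T -> nat) : Prop :=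
  (forall l j, j \in Theta l -> j != head l -> (rank (head l) < rank j)%N) /\
  (forall l m j, j \in Theta l -> j != head l -> j \in Theta m ->
     j != head m -> l = m).

Lemma mem_ballS v i s :
  reflect (v \in ball i s \/
           exists l k, [/\ i \in Theta l, k \in Theta l & v \in ball k s])
    (v \in ball i s.+1).
Proof.
rewrite /= inE; apply: (iffP orP) => -[vi|]; try by left.
- by case/bigcupP=> l il /bigcupP[k kl vk]; right; exists l, k.
- by case=> l [k [il kl vk]]; right; apply/bigcupP; exists l => //;
    apply/bigcupP; exists k.
Qed.

Lemma ball_pred v i t : v \in ball i t.-1 -> v \in ball i t.
Proof. by case: t => // t vi; apply/mem_ballS; left. Qed.

Lemma ball_center i t : i \in ball i t.
Proof. by elim: t => [|t IHt]; [rewrite inE | apply: ball_pred]. Qed.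

(** A walk from [i] to [v] that changes sides of [D] crosses inside some [Theta l]; the walk left
    after the crossing has length at most [t.-1]. *)
Lemma ball_cross (D : {set T}) v i t :
  v \in ball i t -> (i \in D) != (v \in D) ->
  exists l a b, [/\ (0 < t)%N, a \in Theta l, b \in Theta l,
    (a \in D) = (i \in D) & (b \in D) = (v \in D) /\ v \in ball b t.-1].
Proof.
elim: t i => [|t IHt] i; first by rewrite inE => /eqP->; rewrite eqxx.
case/mem_ballS=> [vi|[l [k [il kl vk]]]] iDv.
  have [l [a [b [_ al bl aD [bD vb]]]]] := IHt i vi iDv.
  by exists l, a, b; split=> //; split=> //; apply: ball_pred.
(* Either the first step, from [i] to [k], is the crossing, or it comes later. *)
have [kD|kD] := eqVneq (k \in D) (v \in D).
  by exists l, i, k.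
have kiD : (k \in D) = (i \in D).
  by move: iDv kD; case: (i \in D); case: (v \in D); case: (k \in D).
have [m [a [b [_ am bm aD [bD vb]]]]] := IHt k vk kD.
by exists m, a, b; rewrite aD kiD; split=> //; split=> //; apply: ball_pred.
Qed.

Variables (head : I -> T) (rank : T -> nat).
Hypothesis forestP : forest head rank.

(** * Descendants and separation *)

Definition child_of : rel T :=
  fun x y => [exists l, [&& x \in Theta l, x != head l & y == head l]].

(* The descendants of K, members included; only edges through the link that a
   member of K joined as a non-head leave this set (below_exit). *)
Definition below (K : {set T}) : {set T} :=
  [set x | [exists k in K, connect child_of x k]].

Lemma belowP (K : {set T}) x :
  reflect (exists2 k, k \in K & connect child_of x k) (x \in below K).
Proof. by rewrite inE; apply: exists_inP. Qed.

Lemma sub_below (K : {set T}) x : x \in K -> x \in below K.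
Proof. by move=> xK; apply/belowP; exists x; rewrite ?connect0. Qed.

Lemma connect_child x y : connect child_of x y ->
  x = y \/ exists l, [/\ x \in Theta l, x != head l
                       & connect child_of (head l) y].
Proof.
case/connectP=> -[|z p] /=; first by move=> _ ->; left.
case/andP=> /existsP[l /and3P[xl xh /eqP->]] zp yE; right; exists l.
by split=> //; apply/connectP; exists p.
Qed.

Lemma child_of_head l x : x \in Theta l -> x != head l -> child_of x (head l).
Proof. by move=> xl xh; apply/existsP; exists l; rewrite xl xh eqxx. Qed.

Lemma head_below (K : {set T}) l x :
  x \in Theta l -> head l \in below K -> x \in below K.
Proof.
move=> xl hK; have [->//|/(child_of_head xl)/connect1 xh] := eqVneq x (head l).
case/belowP: hK => k kK hk; apply/belowP; exists k => //.
exact: connect_trans xh hk.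
Qed.

Lemma rank_connect x y : connect child_of x y -> (rank y <= rank x)%N.
Proof.
case/connectP=> p; elim: p x => [|z p IHp] x /= => [_ ->//|].
case/andP=> /existsP[l /and3P[xl xh /eqP ->]] /IHp{}IHp /IHp yh.
by apply: leq_trans yh _; apply/ltnW/forestP.1.
Qed.

(** The head of [l] is not below [K], since otherwise all of [Theta l] would be. So [x] is a
    non-head, and were it outside [K], its chain up to [K] would pass through that head, its only
    parent. *)
Lemma below_exit (K : {set T}) l x y : x \in Theta l -> y \in Theta l ->
  x \in below K -> y \notin below K -> x \in K /\ x != head l.
Proof.
move=> xl yl xK yK.
have hK : head l \notin below K by apply: contra yK; apply: head_below.
have xh : x != head l by apply: contraNneq hK => <-.
split=> //; case/belowP: xK => k kK /connect_child[->//|[m [xm xhm hk]]].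
case/belowP: hK; exists k => //.
by rewrite (forestP.2 _ _ _ xl xh xm xhm).
Qed.

(** A chain from [i] to [j] would pass through [head l], but ranks never increase along a chain and
    [head l] has smaller rank than [j]. *)
Lemma sibling_not_below l i j : i \in Theta l -> j \in Theta l ->
  j != head l -> i != j -> i \notin below [set j].
Proof.
move=> il jl jh ij; apply/belowP=> -[k /set1P-> ij'].
have hN : ~ connect child_of (head l) j.
  by move/rank_connect; rewrite leqNgt forestP.1.
have [iE|ih] := eqVneq i (head l); first by apply: hN; rewrite -iE.
case/connect_child: ij' => [iE|[m [im ihm hj]]]; first by rewrite iE eqxx in ij.
by apply: hN; rewrite (forestP.2 _ _ _ il ih im ihm).
Qed.

(** Take [j] to be a non-head. Its descendants are left only from [j] through [Theta l], so the walk
    to [v] that starts on the other side from [v] crosses there. The crossing ends in a member of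
    [Theta l] one step closer to [v]. *)
Lemma balls_in_link_meet l i j s v : i \in Theta l -> j \in Theta l ->
  i != j -> v \in ball i s -> v \in ball j s ->
  (0 < s)%N /\ exists2 k, k \in Theta l & v \in ball k s.-1.
Proof.
wlog jh : i j / j != head l => [th|] il jl ij vi vj.
  have [jE|] := eqVneq j (head l); last by move=> jh; apply: (th i j).
  by apply: (th j i) => //; rewrite -?jE // eq_sym.
have iD := sibling_not_below il jl jh ij.
have jD : j \in below [set j] by apply: sub_below; rewrite inE.
have [vD|vD] := boolP (v \in below [set j]).
  have ivD : (i \in below [set j]) != (v \in below [set j]).
    by rewrite vD (negPf iD).
  have [m [a [b [s0 am bm aE [bE vb]]]]] := ball_cross vi ivD.
  rewrite vD in bE; rewrite (negPf iD) in aE.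
  have [/set1P bj _] := below_exit bm am bE (negbT aE).
  by split=> //; exists j; rewrite // -bj.
have jvD : (j \in below [set j]) != (v \in below [set j]).
  by rewrite jD (negPf vD).
have [m [a [b [s0 am bm aE [bE vb]]]]] := ball_cross vj jvD.
rewrite jD in aE; rewrite (negPf vD) in bE.
have [/set1P aj ah] := below_exit am bm aE (negbT bE).
rewrite aj in am ah; rewrite -(forestP.2 _ _ _ jl jh am ah) in bm.
by split=> //; exists b.
Qed.

(** The source [i] separates the rest of [Theta l] from [Theta m], so one of the two walks to [v]
    passes through [i]. *)
Lemma balls_across_links l m i j k s v : l != m ->
  i \in Theta l -> i \in Theta m -> j \in Theta l -> k \in Theta m ->
  v \in ball j s -> v \in ball k s -> v \in ball i s.
Proof.
(* A source is a non-head of at most one link, so [i] is the head of [l] or of [m]. *)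
wlog ih : l m j k / i = head l => [th|] lm il im jl km vj vk.
  have [ih|ilh] := eqVneq i (head l); first exact: (th l m j k).
  have [imh|imh] := eqVneq i (head m); last first.
    by move: lm; rewrite (forestP.2 _ _ _ il ilh im imh) eqxx.
  by apply: (th m l k j) => //; rewrite eq_sym.
have [<-//|ji] := eqVneq j i.
set K := [set x in Theta l | x != head l].
have jD : j \in below K by apply: sub_below; rewrite inE jl -ih.
have iD : i \notin below K.
  apply/belowP=> -[x]; rewrite inE => /andP[xl xh] /rank_connect.
  by rewrite leqNgt ih forestP.1.
(* Otherwise [k], sharing [Theta m] with the outside source [i], would be a non-head of both [l] and
   [m]. *)
have kD : k \notin below K.
  apply/negP=> kD; have [] := below_exit km im kD iD.
  rewrite inE => /andP[kl kh] khm.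
  by move: lm; rewrite (forestP.2 _ _ _ kl kh km khm) eqxx.
(* An exit from [below K] starts at a non-head of [l], hence stays in [Theta l], whose only outside
   member is its head [i]. *)
have exit_head n a b : a \in Theta n -> b \in Theta n ->
    a \in below K -> b \notin below K -> a \in Theta l /\ b = i.
  move=> an bn aD bD; have [] := below_exit an bn aD bD.
  rewrite inE => /andP[al ah] ahn; split=> //.
  rewrite -(forestP.2 _ _ _ al ah an ahn) in bn; rewrite ih; apply/eqP.
  by apply: contraNT bD => bh; apply: sub_below; rewrite inE bn.
have [vD|vD] := boolP (v \in below K).
  have kvD : (k \in below K) != (v \in below K) by rewrite vD (negPf kD).
  have [n [a [b [s0 an bn aE [bE vb]]]]] := ball_cross vk kvD.
  rewrite vD in bE; rewrite (negPf kD) in aE.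
  have [bl _] := exit_head _ _ _ bn an bE (negbT aE).
  by rewrite -(prednK s0); apply/mem_ballS; right; exists l, b.
have jvD : (j \in below K) != (v \in below K) by rewrite jD (negPf vD).
have [n [a [b [s0 an bn aE [bE vb]]]]] := ball_cross vj jvD.
rewrite jD in aE; rewrite (negPf vD) in bE.
have [_ bi] := exit_head _ _ _ an bn aE (negbT bE).
by apply: ball_pred; rewrite -bi.
Qed.

Lemma sum_link_ball (R : realType) (w : T -> R) l t :
  \sum_(v in link_ball l t.+1) w v
  = \sum_(i in Theta l) \sum_(v in ball i t) w v
    - (#|Theta l|%:R - 1) * \sum_(v in link_ball l t) w v.
Proof.
rewrite -sum_sunflower => [|i il|i j il jl ij].
- rewrite (setUidPr _) //; case: t => [|t]; first exact: finset.sub0set.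
  by apply/bigcupsP=> k kl; apply: (bigcup_max k) => //; apply: finset.subsetUl.
- case: t => [|t]; first exact: finset.sub0set.
  apply/bigcupsP=> k kl; apply/subsetP=> v vk.
  by apply/mem_ballS; right; exists l, k.
- apply/subsetP=> v /setIP[vi vj].
  have [] := balls_in_link_meet il jl ij vi vj.
  by case: t {vi vj} => // t _ [k kl vk]; apply/bigcupP; exists k.
Qed.

(** Links with [Theta l = [set i]] may be left out of [P]: they contribute only [ball i t], which
    the kernel supplies. *)
Lemma sum_ball (R : realType) (w : T -> R) (P : {set I}) i t :
  (forall l, (l \in P) = (i \in Theta l) && (1 < #|Theta l|)%N) ->
  \sum_(v in ball i t.+1) w v
  = \sum_(l in P) \sum_(v in link_ball l t.+1) w v
    - (#|P|%:R - 1) * \sum_(v in ball i t) w v.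
Proof.
move=> PE; rewrite -sum_sunflower => [|l|l m].
- apply: eq_bigl => v; apply/mem_ballS/setUP => -[vi|]; try by left.
    case=> l [k [il kl vk]]; have [l1|l1] := ltnP 1 #|Theta l|.
      right; apply/bigcupP; exists l; first by rewrite PE il.
      by apply/bigcupP; exists k.
    by left; rewrite (card_le1_eqP l1 k i kl il).
  case/bigcupP=> l; rewrite PE => /andP[il _] /bigcupP[k kl vk].
  by right; exists l, k.
- by rewrite PE => /andP[il _]; apply: (bigcup_sup i).
- rewrite !PE => /andP[il _] /andP[im _] lm; apply/subsetP=> v.
  case/setIP=> /bigcupP[j jl vj] /bigcupP[k km vk].
  exact: (balls_across_links lm il im jl km vj vk).
Qed.

End Forest.

(** * Invariants of the construction *)

Section Construction.
Variables (nS nL : nat) (net : network nS nL).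

(** Together the clauses say that distinct sources are adjacent exactly when some [Theta st l]
    contains both. *)
Definition labelled_cliques (st : state nS nL) : Prop :=
  (forall l a b, a \in Theta st l -> b \in Theta st l -> a != b ->
     ([set a; b], l) \in edges st) /\
  (forall e, e \in edges st -> exists a b,
     [/\ a \in Theta st e.2, b \in Theta st e.2 & e.1 = [set a; b]]).

Definition heads_valid (st : state nS nL) (head : 'I_nL -> 'I_nS) : Prop :=
  forall l, Theta st l != set0 -> head l \in Theta st l.

(* A valid rank of a source is the iteration in which it turned grey. *)
Definition construction_invariant (n : nat) (st : state nS nL) : Prop :=
  [/\ labelled_cliques st,
      forall l, Theta st l \subset grey st
    & exists head rank, [/\ heads_valid st head, forest (Theta st) head rank
                          & forall i, (rank i <= n)%N]].

Lemma foldl_process_neighbor l s (acc : {set 'I_nS} * {set edge nS nL}) i :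
  (i \in (foldl (process_neighbor l) acc s).1) = (i \in acc.1) || (i \in s).
Proof.
elim: s acc => [|j s IHs] acc; first by rewrite orbF.
by rewrite /= IHs !inE [RHS]orbCA orbA.
Qed.

(** [E] stands for the edges of earlier iterations, which already join the old members; processing
    adds the pairs with a newcomer. *)
Lemma foldl_process_neighbor_clique l s (acc : {set 'I_nS} * {set edge nS nL})
    (E : {set edge nS nL}) :
  let acc' := foldl (process_neighbor l) acc s in
  (forall a b, a \in acc.1 -> b \in acc.1 -> a != b ->
     ([set a; b], l) \in E :|: acc.2) ->
  forall a b, a \in acc'.1 -> b \in acc'.1 -> a != b ->
     ([set a; b], l) \in E :|: acc'.2.
Proof.
elim: s acc => [|j s IHs] acc //= accE; apply: IHs => a b /=.
rewrite !inE => /orP[/eqP->|aA] /orP[/eqP->|bA] ab; first by rewrite eqxx in ab.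
- by rewrite imset_f ?orbT.
- by rewrite finset.setUC imset_f ?orbT.
- by move: (accE a b aA bA ab); rewrite inE => /orP[]->; rewrite ?orbT.
Qed.

Lemma foldl_process_neighbor_sound l s (acc : {set 'I_nS} * {set edge nS nL}) :
  let acc' := foldl (process_neighbor l) acc s in
  (forall e, e \in acc.2 -> exists a b,
     [/\ e.2 = l, a \in acc.1, b \in acc.1 & e.1 = [set a; b]]) ->
  forall e, e \in acc'.2 -> exists a b,
     [/\ e.2 = l, a \in acc'.1, b \in acc'.1 & e.1 = [set a; b]].
Proof.
elim: s acc => [|j s IHs] acc //= accE; apply: IHs => e /=.
rewrite inE => /orP[/accE[a [b [el aA bA eE]]]|/imsetP[b bA ->]].
  by exists a, b; split; rewrite // inE ?aA ?bA orbT.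
by exists j, b; split; rewrite // !inE ?eqxx ?bA ?orbT.
Qed.

Lemma mem_link_update st l p i :
  (i \in (link_update net st l p).1) =
  if Theta st l == set0 then i \in Defs.smallest (label_signals net st l)
  else (i \in Theta st l) || (i \in neighbor_signals net st l).
Proof.
rewrite /link_update; case: ifP => // _; rewrite foldl_process_neighbor /=.
(* A permutation lists every source, so the processing order does not affect membership. *)
rewrite mem_filter (_ : i \in map p _) ?andbT //.
by rewrite -(permKV p i) map_f // mem_enum.
Qed.

Lemma smallest_inj (A : {set 'I_nS}) i j :
  i \in Defs.smallest A -> j \in Defs.smallest A -> i = j.
Proof.
rewrite !inE => /andP[iA /forall_inP ih] /andP[jA /forall_inP jh].
by apply/val_inj/eqP; rewrite eqn_leq ih ?jh.
Qed.

Lemma link_update_new st l p i : i \in (link_update net st l p).1 ->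
  i \in Theta st l \/ i \in new_grey net st.
Proof.
rewrite mem_link_update; case: ifP => _; last case/orP; try by left.
  by rewrite inE => /andP[]; rewrite inE => /andP[]; right.
by rewrite inE => /andP[]; right.
Qed.

Lemma Theta_link_update st l p : Theta st l \subset (link_update net st l p).1.
Proof.
apply/subsetP=> i il; rewrite mem_link_update il; case: eqP => // l0.
by rewrite l0 inE in il.
Qed.

(* A neighbor signal is stopped by the first nonempty link of its route. *)
Lemma neighbor_signal_link st l m i :
  Theta st l != set0 -> Theta st m != set0 ->
  i \in neighbor_signals net st l -> i \in neighbor_signals net st m -> l = m.
Proof.
move=> l0 m0; rewrite !inE => /andP[_ /andP[il /allP al]].
case/andP=> _ /andP[im /allP am].
have idx k k' : Theta st k' != set0 -> k' \in route net i ->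
    (forall n, n \in take (index k (route net i)) (route net i) ->
       Theta st n == set0) ->
    (index k (route net i) <= index k' (route net i))%N.
  move=> k0 kr ak; rewrite leqNgt; apply/negP => lt.
  by case/negP: k0; apply: ak; rewrite in_take.
have /eqP : index l (route net i) == index m (route net i).
  by rewrite eqn_leq !idx.
by move/(congr1 (nth l (route net i))); rewrite !nth_index.
Qed.

Lemma init_invariant i0 : construction_invariant 0 (init_state net i0).
Proof.
have Theta0 l i : i \in Theta (init_state net i0) l -> i = i0.
  by rewrite /=; case: ifP => _; rewrite inE => // /eqP.
split; first split=> [l a b /Theta0-> /Theta0->|e]; rewrite ?eqxx ?inE //.
  by move=> l; apply/subsetP=> i /Theta0 ->; rewrite inE.
exists (fun=> i0), (fun=> 0%N); split=> //.
  by move=> l /set0Pn[i il]; move: (il); rewrite {1}(Theta0 _ _ il).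
by split=> [l j /Theta0->|l m j /Theta0->]; rewrite eqxx.
Qed.

Lemma iteration_cliques p st :
  labelled_cliques st -> labelled_cliques (iteration net p st).
Proof.
move=> [cl snd]; split=> [l a b|e].
  have sub : edges st :|: (link_update net st l (p l)).2
      \subset edges (iteration net p st).
    by apply: finset.setUS; apply: (bigcup_sup l).
  rewrite /= => al bl ab; apply: (subsetP sub).
  move: al bl ab; rewrite /link_update; case: ifP => l0.
    by move=> al bl; rewrite (smallest_inj al bl) eqxx.
  apply: foldl_process_neighbor_clique => a' b' /= a'l b'l a'b'.
  by rewrite inE cl.
rewrite inE => /orP[/snd[a [b [ae be eE]]]|/bigcupP[l _]].
  by exists a, b; split=> //; apply: (subsetP (Theta_link_update _ _ _)).
rewrite /= /link_update; case: ifP => l0; first by rewrite inE.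
case/foldl_process_neighbor_sound => [e'|a [b [el al bl eE]]].
  by rewrite inE.
by exists a, b; split; rewrite // el /link_update l0.
Qed.

(** Newly grey sources lay in no set before and get a rank above all old ones. An empty link takes
    at most one of them, as its head. A nonempty link keeps its head, and a newcomer joins at most
    one such link, where its neighbor signal stops. *)
Lemma iteration_invariant n p st :
  construction_invariant n st ->
  construction_invariant n.+1 (iteration net p st).
Proof.
move=> [cl gr [head [rank [hv [rk one] rn]]]].
split; first exact: iteration_cliques.
  move=> l; apply/subsetP=> i /link_update_new il; apply/setUP.
  by case: il => [/(subsetP (gr l))|]; [left | right].
pose Theta' l := (link_update net st l (p l)).1.
(* The default [head l] is used only when the set stays empty. *)
pose head' l := if Theta st l == set0
  then odflt (head l) [pick i in Theta' l] else head l.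
pose rank' i := if i \in new_grey net st then n.+1 else rank i.
have old_not_new l i : i \in Theta st l -> i \notin new_grey net st.
  by move/(subsetP (gr l)) => ig; rewrite inE ig.
have nonhead l j : j \in Theta' l -> j != head' l ->
    [/\ Theta st l != set0, head' l = head l
      & j \in Theta st l \/ j \in neighbor_signals net st l].
  rewrite /head' /Theta' => jl; move: (jl).
  rewrite mem_link_update; case: ifP => [l0 js|l0 /orP jl' _]; last by split.
  case: pickP => [i|/(_ j)]; last by rewrite jl.
  by rewrite mem_link_update l0 => is_ /=; rewrite (smallest_inj js is_) eqxx.
have nb_new l j : j \in neighbor_signals net st l -> j \in new_grey net st.
  by rewrite inE => /andP[].
exists head', rank'; split.
- move=> l; rewrite /head'; case: ifP => [_ /set0Pn[i il]|l0 _].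
    by case: pickP => // /(_ i); rewrite [_ \in _]il.
  by apply: (subsetP (Theta_link_update _ _ _)); apply: hv; rewrite l0.
- split=> [l j jl jh|l m j jl jhl jm jhm].
    have [l0 hE jl'] := nonhead _ _ jl jh.
    have hl := hv _ l0; rewrite hE /rank' (negPf (old_not_new _ _ hl)).
    case: jl' => [jl'|/nb_new->]; last by rewrite ltnS.
    by rewrite (negPf (old_not_new _ _ jl')) rk // -hE.
  have [l0 hlE jl'] := nonhead _ _ jl jhl.
  have [m0 hmE jm'] := nonhead _ _ jm jhm.
  case: jl' jm' => [jl'|jl'] [jm'|jm'].
  + by apply: (one l m j); rewrite // -?hlE -?hmE.
  + by case/negP: (old_not_new _ _ jl'); apply: nb_new jm'.
  + by case/negP: (old_not_new _ _ jm'); apply: nb_new jl'.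
  + exact: neighbor_signal_link jl' jm'.
- by move=> i; rewrite /rank'; case: ifP => // _; apply: leqW.
Qed.

Lemma state_after_invariant i0 order n :
  construction_invariant n (state_after net i0 order n).
Proof.
elim: n => [|n IHn]; first exact: init_invariant.
exact: iteration_invariant.
Qed.

(** * Graph neighborhoods as balls *)

Lemma nbhdP (st : state nS nL) i t v :
  reflect (exists p, [/\ (size p <= t)%N, path (adj st) i p & last i p = v])
    (v \in nbhd st i t).
Proof.
rewrite inE; apply: (iffP existsP) => [[n /existsP[p /andP[ip /eqP pv]]]|].
  by exists p; split=> //; rewrite size_tuple -ltnS.
case=> p [pt ip pv]; exists (Ordinal (pt : (size p < t.+1)%N)).
by apply/existsP; exists (in_tuple p); rewrite /= ip pv eqxx.
Qed.

Lemma nbhd_ball (st : state nS nL) i t :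
  labelled_cliques st -> nbhd st i t = ball (Theta st) i t.
Proof.
move=> [cl snd]; elim: t i => [|t IHt] i; apply/setP=> v.
  apply/nbhdP/set1P => [[[|k p] [+ _ <-]]|->] //.
  by exists [::].
apply/nbhdP/mem_ballS => [[[|k p] /= [pt]]|].
- by move=> _ <-; left; apply: ball_center.
- case/andP=> /existsP[l /snd[a [b [/= al bl eE]]]] kp pv.
  have [il kl] : i \in Theta st l /\ k \in Theta st l.
    by have : (i \in [set i; k]) && (k \in [set i; k]);
      [rewrite !inE !eqxx orbT
      |rewrite eE !inE => /andP[] /orP[]/eqP->/orP[]/eqP->].
  by right; exists l, k; split; rewrite // -IHt; apply/nbhdP; exists p.
- case=> [|[l [k [il kl]]]]; rewrite -IHt => /nbhdP[p [pt ip pv]].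
    by exists p; split=> //; apply: leqW.
  (* The clique property gives an edge only for [i != k]; if [i = k], the path from [k] already
     serves. *)
  have [ik|ik] := eqVneq i k.
    by exists p; rewrite ik; split=> //; apply: leqW.
  exists (k :: p); split=> //=; rewrite ip andbT.
  by apply/existsP; exists l; apply: cl.
Qed.

End Construction.

(** * Additivity of [sigma] and the final induction *)

Lemma sigmaE (R : realType) nS nL (net : network nS nL) (ys : 'I_nS -> R)
    (zs : 'I_nL -> R) (K : {set 'I_nS}) :
  sigma net ys zs K = \sum_(i in K) (ys i + \sum_(l in links net i) zs l).
Proof.
rewrite /sigma big_split addrC /=; congr (_ + _).
(* Outside the union all indicators vanish, so the sum may run over all links before the
   exchange. *)
have -> : \sum_(l in \bigcup_(i in K) links net i)
            zs l * (\sum_(i in K) (l \in links net i)%:R)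
        = \sum_l zs l * (\sum_(i in K) (l \in links net i)%:R).
  rewrite big_mkcond /=; apply: eq_bigr => l _; case: ifP => // lU.
  rewrite big1 ?mulr0 // => i iK; case: (boolP (l \in links net i)) => // li.
  by case/bigcupP: lU; exists i.
under [LHS]eq_bigr do rewrite big_distrr.
rewrite exchange_big; apply: eq_bigr => i _ /=; rewrite [RHS]big_mkcond.
by apply: eq_bigr => l _; case: ifP; rewrite ?mulr1 ?mulr0.
Qed.


Theorem theoremA4 (R : realType) (nS nL : nat) (net : network nS nL)
    (i0 : 'I_nS) (order : nat -> 'I_nL -> {perm 'I_nS})
    (U : 'I_nS -> R -> R) (mu : R) (c : 'cV[R]_nL) (x dx : 'cV[R]_(nS + nL))
    (y : nat -> 'I_nS -> R) (z : nat -> 'I_nL -> R) :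
  let f := objective U mu in
  let G := aux_graph net i0 order in
  let ys := ystar f x dx in
  let zs := zstar net f x dx in
  (forall i, utility (U i)) ->
  1 <= mu ->
  (forall l, 0 < c l 0) ->
  (forall j, 0 < x j 0) ->
  feasible net c x ->
  inexact_newton_direction net f x dx ->
  summation_iterates net G ys zs y z ->
  forall t : nat, (1 <= t <= nS)%N ->
    (forall l : 'I_nL,
       z t l = sigma net ys zs (\bigcup_(i in Theta G l) nbhd G i t.-1)) /\
    (forall i : 'I_nS, y t i = sigma net ys zs (nbhd G i t)).
Proof.
move=> f G ys zs _ _ _ _ _ _ [z0 y0 zS yS].
have [cl _ [head [rank [_ forestG _]]]] :
  construction_invariant nS.-1 G := state_after_invariant net i0 order nS.-1.
(* This weight is both the initial value [y 0 i] and the share of [i] in [sigma]. *)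
pose w i := ys i + \sum_(l in links net i) zs l.
(* Including [t = 0], with empty link balls and singleton balls, gives the induction its base. *)
have iterates t : (t <= nS)%N ->
    (forall l, z t l = \sum_(v in link_ball (Theta G) l t) w v) /\
    (forall i, y t i = \sum_(v in ball (Theta G) i t) w v).
  elim: t => [_|t IHt tS].
    by split=> [l|i]; rewrite ?z0 ?y0 ?finset.big_set0 ?finset.big_set1.
  have [IHz IHy] := IHt (ltnW tS).
  have zE l : z t.+1 l = \sum_(v in link_ball (Theta G) l t.+1) w v.
    rewrite zS // (sum_link_ball forestG) IHz.
    by congr (_ - _); apply: eq_bigr => i _; apply: IHy.
  split=> // i; rewrite yS // (sum_ball forestG w (P := Lstar_of G i)) => [|l].
    by rewrite IHy; congr (_ - _); apply: eq_bigr => l _; apply: zE.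
  by rewrite !inE andbC.
(* At time [t.+1] the link ball is the union of balls of radius [t], which is the radius [t.-1] of
   the statement. *)
case=> // t /iterates[zE yE]; split=> [l|i]; rewrite sigmaE.
  by rewrite zE; under [in RHS]eq_bigr do rewrite (nbhd_ball _ _ cl).
by rewrite yE nbhd_ball.
Qed.
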